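(* Each of the following proof rules is sound: whenever all of its premises hold (Hoare-triple premises being valid in the sense defined in the context), its conclusion is a valid Hoare triple. Throughout, $P,P_1,P_2,Q,Q_1,Q_2,I,G$ are state predicates, $t$ is a boolean test, $R$ is a transition relation, $U,U_1,U_2,V,V_1,V_2,W$ are regular behavioral specifications, $v$ is a plain regular expression, $a\in A$ is an event, and $c,c_1,c_2,B$ are commands. 1. (Emit) $\{P \mid U\}\ \mathtt{emit}\ a\ \{P \mid U\cdot a\}$, with no premises. 2. (Spec) If for every state $s$, $P_s$ implies $G_s$, and for all states $s$ and all $s' = s[\vec x\mapsto \vec v]$ (any values $\vec v$), $P_s \wedge R_{s,s'}$ implies $Q_{s'}$ and $\mathcal L(U_s\cdot W_s)\subseteq \mathcal L(V_{s'})$, then $\{P\mid U\}\ [\vec x : G \leadsto R \mid W]\ \{Q\mid V\}$ is valid. 3. (Conseq) If for every state $s$, $(P_1)_s$ implies $(P_2)_s$ and $\mathcal L((U_1)_s)\subseteq\mathcal L((U_2)_s)$; $\{P_2\mid U_2\}\ c\ \{Q_2\mid V_2\}$ is valid; and for every state $s$, $(Q_2)_s$ implies $(Q_1)_s$ and $\mathcal L((V_2)_s)\subseteq \mathcal L((V_1)_s)$; then $\{P_1\mid U_1\}\ c\ \{Q_1\mid V_1\}$ is valid. 4. (Seq) If $\{P\mid U\}\ c_1\ \{Q\mid V\}$ and $\{Q\mid V\}\ c_2\ \{R\mid W\}$ are valid (here $R$ is a predicate), then $\{P\mid U\}\ c_1;c_2\ \{R\mid W\}$ is valid. 5. (While)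 If $\{t\wedge I\mid U\}\ B\ \{I\mid U\}$ is valid, then $\{I\mid U\}\ \mathtt{while}\ t\ \mathtt{do}\ B\ \{\neg t\wedge I\mid U\}$ is valid. 6. (Frame) If for all states $s,s'$ with $P_s$ and $Q_{s'}$ we have $\mathcal L(W_s)=\mathcal L(W_{s'})$, and $\{P\mid U\}\ c\ \{Q\mid V\}$ is valid, then $\{P\mid W\cdot U\}\ c\ \{Q\mid W\cdot V\}$ is valid. 7. (While* ) If $\{t\wedge I\mid \epsilon\}\ B\ \{I\mid v\}$ is valid, then $\{I\mid \epsilon\}\ \mathtt{while}\ t\ \mathtt{do}\ B\ \{\neg t\wedge I\mid v^*\}$ is valid.
   Context: Plain regular expressions over a finite alphabet $A$ of events: $u ::= \varnothing \mid \epsilon \mid a \mid u\cdot v \mid u\mid v \mid u^*$ with the usual languages $\mathcal L(u)$ of finite words (traces) $\tau=\langle a_1,\dots,a_n\rangle$. States $s\in S$ assign values to program variables; predicates are evaluated in a state ($P_s$), relations $R$ in a pair of states ($R_{s,s'}$, primed variables read from $s'$). $s[\vec x\mapsto\vec v]$ is $s$ with variables $\vec x$ updated to values $\vec v$. A regular behavioral specification is $U = u_1\ \mathtt{if}\ \phi_1 \mid \dots\mid u_n\ \mathtt{if}\ \phi_n$ with plain regular expressions $u_i$ and state predicates $\phi_i$; a plain regular expression $u$ is identified with $u\ \mathtt{if}\ \mathit{true}$. Its evaluation in state $s$ is the plain regular expression $U_s = (u_1\ \mathtt{if}\ \phi_1)_s\mid\dots\mid(u_n\ \mathtt{if}\ \phi_n)_s$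 where $(u\ \mathtt{if}\ \phi)_s = u$ if $\phi_s$ holds and $\varnothing$ otherwise. Concatenation of specifications is evaluated pointwise in the same state: $(U\cdot V)_s = U_s\cdot V_s$ (in particular $(U\cdot a)_s=U_s\cdot a$). Commands: $c ::= [\vec x : G\leadsto R\mid U] \mid c_1;c_2 \mid \mathtt{if}\ t\ \mathtt{then}\ c_1\ \mathtt{else}\ c_2 \mid \mathtt{while}\ t\ \mathtt{do}\ c$, and $\mathtt{emit}\ a$ abbreviates $[\,- : \mathit{true}\leadsto \mathit{true}\mid a]$ (no modified variables). Big-step semantics $k\xrightarrow{\tau}k'$ from configurations $\langle s,c\rangle$ to $\langle s'\rangle$ (normal termination) or $\mathbf{abort}$, labelled by the emitted trace $\tau$: $\langle s,[\vec x:G\leadsto R\mid U]\rangle\xrightarrow{\tau}\mathbf{abort}$ for arbitrary $\tau$ if $G_s$ fails; $\langle s,[\vec x:G\leadsto R\mid U]\rangle\xrightarrow{\tau}\langle s'\rangle$ if $G_s$, $R_{s,s'}$, $\tau\in\mathcal L(U_s)$ and $s'=s[\vec x\mapsto\vec v]$ for some $\vec v$. Sequencing, conditionals and loops follow the standard big-step rules, concatenating the traces of consecutive steps and propagating $\mathbf{abort}$; diverging runs produce no transition. A Hoare triple $\{P\mid U\}\ c\ \{Q\mid V\}$ is valid if for all states $s$, traces $\tau$ and configurations $k'$: if $P_s$ and $\langle s,c\rangle\xrightarrow{\tau}k'$ then $k'=\langle s'\rangle$ for some $s'$ with $Q_{s'}$ and $\mathcal L(U_s\cdot\tau)\subseteq\mathcal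 L(V_{s'})$. *)

(* Defs.v *)
From mathcomp Require Import all_boot.
From mathcomp Require Import boolp classical_sets.

Set Implicit Arguments.
Unset Strict Implicit.
Unset Printing Implicit Defensive.

Local Open Scope classical_set_scope.

Inductive regex (A : Type) : Type :=
| REmpty
| REps
| RSym of A
| RCat of regex A & regex A
| RAlt of regex A & regex A
| RStar of regex A.

Arguments REmpty {A}.
Arguments REps {A}.

Section Languages.
Variable A : Type.
Implicit Types (u v : regex A) (L M : set (seq A)).

Definition lang_cat L M : set (seq A) := [set x ++ y | x in L & y in M].

Definition lang_star L : set (seq A) :=
  \bigcup_n iter n (lang_cat L) [set [::]].

Fixpoint lang u : set (seq A) :=
  match u with
  | REmpty => set0
  | REps => [set [::]]
  | RSym a => [set [:: a]]
  | RCat u1 u2 => lang_cat (lang u1) (lang u2)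
  | RAlt u1 u2 => lang u1 `|` lang u2
  | RStar u1 => lang_star (lang u1)
  end.

Definition re_of_trace (tau : seq A) : regex A :=
  foldr (fun a u => RCat (RSym a) u) REps tau.

End Languages.

Definition state (Var Val : Type) : Type := Var -> Val.

(* s[xs |-> vs], where xs and vs are meant to have the same length. If a
   variable is repeated in xs, the last corresponding value is taken. *)
Definition update (Var : eqType) (Val : Type) (s : state Var Val)
    (xs : seq Var) (vs : seq Val) : state Var Val :=
  foldl (fun s' p => [eta s' with p.1 |-> p.2]) s (zip xs vs).

Section Specifications.
Variables (A S : Type).

(* SAlts [:: (u_1, phi_1); ...; (u_n, phi_n)] is
   u_1 if phi_1 | ... | u_n if phi_n. Concatenation is a constructor so that
   (U . V)_s is literally U_s . V_s. *)
Inductive spec : Type :=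
| SAlts of seq (regex A * (S -> Prop))
| SCat of spec & spec.

Definition eval_branch (s : S) (b : regex A * (S -> Prop)) : regex A :=
  if `[< b.2 s >] then b.1 else REmpty.

(* The first branch is the starting value of the fold, so that a specification
   with a single branch evaluates to that branch itself. *)
Fixpoint eval (U : spec) (s : S) : regex A :=
  match U with
  | SAlts [::] => REmpty
  | SAlts (b :: bs) =>
      foldl (fun u b' => RAlt u (eval_branch s b')) (eval_branch s b) bs
  | SCat U1 U2 => RCat (eval U1 s) (eval U2 s)
  end.

Definition plain (u : regex A) : spec := SAlts [:: (u, fun=> True)].

End Specifications.

Arguments plain {A S} u.

Section Commands.
Variables (A : Type) (Var : eqType) (Val : Type).
Notation S := (state Var Val).
Notation spec := (spec A S).

(* CSpec xs G R U is [xs : G ~> R | U]. *)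
Inductive cmd : Type :=
| CSpec of seq Var & (S -> Prop) & (S -> S -> Prop) & spec
| CSeq of cmd & cmd
| CIf of pred S & cmd & cmd
| CWhile of pred S & cmd.

Definition emit (a : A) : cmd :=
  CSpec [::] (fun=> True) (fun _ _ => True) (plain (RSym a)).

Inductive outcome : Type :=
| Terminated of S
| Aborted.

Inductive exec : S -> cmd -> seq A -> outcome -> Prop :=
| exec_spec_abort s xs (G : S -> Prop) R U tau :
    ~ G s ->
    exec s (CSpec xs G R U) tau Aborted
| exec_spec s xs vs (G : S -> Prop) (R : S -> S -> Prop) U tau :
    size vs = size xs ->
    G s ->
    R s (update s xs vs) ->
    lang (eval U s) tau ->
    exec s (CSpec xs G R U) tau (Terminated (update s xs vs))
| exec_seq s s1 c1 c2 tau1 tau2 k :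
    exec s c1 tau1 (Terminated s1) ->
    exec s1 c2 tau2 k ->
    exec s (CSeq c1 c2) (tau1 ++ tau2) k
| exec_seq_abort s c1 c2 tau :
    exec s c1 tau Aborted ->
    exec s (CSeq c1 c2) tau Aborted
| exec_if_true s (t : pred S) c1 c2 tau k :
    t s ->
    exec s c1 tau k ->
    exec s (CIf t c1 c2) tau k
| exec_if_false s (t : pred S) c1 c2 tau k :
    ~~ t s ->
    exec s c2 tau k ->
    exec s (CIf t c1 c2) tau k
| exec_while_false s (t : pred S) c :
    ~~ t s ->
    exec s (CWhile t c) [::] (Terminated s)
| exec_while_true s s1 (t : pred S) c tau1 tau2 k :
    t s ->
    exec s c tau1 (Terminated s1) ->
    exec s1 (CWhile t c) tau2 k ->
    exec s (CWhile t c) (tau1 ++ tau2) k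
| exec_while_abort s (t : pred S) c tau :
    t s ->
    exec s c tau Aborted ->
    exec s (CWhile t c) tau Aborted.

(* Validity of {P | U} c {Q | V}. *)
Definition hoare (P : S -> Prop) (U : spec) (c : cmd)
    (Q : S -> Prop) (V : spec) : Prop :=
  forall s tau k, P s -> exec s c tau k ->
    exists s', [/\ k = Terminated s', Q s' &
      lang (RCat (eval U s) (re_of_trace tau)) `<=` lang (eval V s')].

End Commands.

Arguments emit {A Var Val} a.

(* Main.v *)
Require Import Defs.
From mathcomp Require Import all_boot.
From mathcomp Require Import boolp classical_sets.

Set Implicit Arguments.
Unset Strict Implicit.
Unset Printing Implicit Defensive.

Local Open Scope classical_set_scope.

(** A trace denotes a one-word language, so the inclusion in a valid triple says that every history
    [x] of the precondition, extended by the emitted [tau], is a history of the postcondition. In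
    this pointwise form ([hoareP]), Spec, Conseq, Seq and Frame follow by chaining such implications
    and associativity of concatenation, and While by induction on the execution. Emit is an instance
    of Spec. While* combines Frame, Conseq and While, with the star of [v] as the invariant
    history. *)

Section Languages.
Variable A : Type.

Lemma lang_re_of_trace (tau : seq A) : lang (re_of_trace tau) = [set tau].
Proof.
elim: tau => [//|a tau IH] /=; rewrite IH; apply/seteqP; split=> x /=.
  by case=> _ -> [_ -> <-].
by move=> ->; exists [:: a] => //; exists tau.
Qed.

Lemma lang_cat_trace_sub (u : regex A) (tau : seq A) (L : set (seq A)) :
  lang (RCat u (re_of_trace tau)) `<=` L <->
  forall x, lang u x -> L (x ++ tau).
Proof.
rewrite /= lang_re_of_trace; split=> [sub x ux|sub _ [x ux [_ -> <-]]].
  by apply: sub; exists x => //; exists tau.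
exact: sub.
Qed.

Lemma lang_star_nil (L : set (seq A)) : lang_star L [::].
Proof. by exists 0. Qed.

(** Powers of [L] are built by adding factors on the left, whereas a loop appends its newest trace
    on the right; induction on the exponent carries [y] past the earlier factors. *)
Lemma lang_star_catr (L : set (seq A)) (x y : seq A) :
  lang_star L x -> L y -> lang_star L (x ++ y).
Proof.
case=> n _ Lx Ly; exists n.+1 => //.
elim: n x Lx => [_ ->|n IH _ [x1 Lx1 [x2 Lx2 <-]]].
  by exists y => //; exists [::]; rewrite ?cats0.
by rewrite -catA; exists x1 => //; exists (x2 ++ y) => //; apply: IH.
Qed.

Lemma eval_plain (S : Type) (u : regex A) (s : S) : eval (plain u) s = u.
Proof. by rewrite /= /eval_branch /= asboolT. Qed.

End Languages.

Section Rules.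
Variables (A : Type) (Var : eqType) (Val : Type).
Notation S := (state Var Val).
Implicit Types (P Q I G : S -> Prop) (U V W : spec A S) (c B : cmd A Var Val).

Lemma hoareP P U c Q V :
  hoare P U c Q V <->
  forall s tau k, P s -> exec s c tau k ->
    exists s', [/\ k = Terminated s', Q s' &
      forall x, lang (eval U s) x -> lang (eval V s') (x ++ tau)].
Proof.
split=> valid s tau k Ps /(valid _ _ _ Ps) [s' [-> Qs' sub]]; exists s';
  by split=> //; apply/lang_cat_trace_sub.
Qed.

Lemma hoare_spec P G Q (R : S -> S -> Prop) U V W (xs : seq Var) :
  (forall s, P s -> G s) ->
  (forall s s' (vs : seq Val), size vs = size xs -> s' = update s xs vs ->
    P s /\ R s s' ->
    Q s' /\ lang (RCat (eval U s) (eval W s)) `<=` lang (eval V s')) ->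
  hoare P U (CSpec xs G R W) Q V.
Proof.
move=> PG step; apply/hoareP => s tau k Ps ex; inversion ex; subst.
  by have := PG _ Ps.
have [//|//|Qs' sub] := step s _ vs _ erefl; exists (update s xs vs).
by split=> // x Ux; apply: sub; exists x => //; exists tau.
Qed.

(** With no modified variables the final state is [s] itself, so both sides of the inclusion
    required by [hoare_spec] evaluate to the same expression. *)
Lemma hoare_emit P U (a : A) : hoare P U (emit a) P (SCat U (plain (RSym a))).
Proof. by apply: hoare_spec => // s s' [|? ?] // _ -> [Ps _]; split. Qed.

Lemma hoare_conseq P1 P2 Q1 Q2 U1 U2 V1 V2 c :
  (forall s, P1 s -> P2 s /\ lang (eval U1 s) `<=` lang (eval U2 s)) ->
  hoare P2 U2 c Q2 V2 ->
  (forall s, Q2 s -> Q1 s /\ lang (eval V2 s) `<=` lang (eval V1 s)) ->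
  hoare P1 U1 c Q1 V1.
Proof.
move=> pre /hoareP valid post; apply/hoareP => s tau k /pre [P2s subU].
move=> /(valid _ _ _ P2s) [s' [-> /post [Q1s' subV] UV]]; exists s'.
by split=> // x /subU /UV /subV.
Qed.

Lemma hoare_seq P Q (R : S -> Prop) U V W c1 c2 :
  hoare P U c1 Q V -> hoare Q V c2 R W -> hoare P U (CSeq c1 c2) R W.
Proof.
move=> /hoareP valid1 /hoareP valid2; apply/hoareP => s tau k Ps ex.
inversion ex as [| |? s1 ? ? tau1 tau2 ? ex1 ex2|? ? ? ? ex1| | | | |]; subst;
  (* Validity of the first triple forces [c1] to terminate normally, which refutes the abort
     case. *)
  have [_ [// [<-] Qs1 UV]] := valid1 _ _ _ Ps ex1.
have [s2 [-> Rs2 VW]] := valid2 _ _ _ Qs1 ex2; exists s2.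
by split=> // x /UV /VW; rewrite catA.
Qed.

Lemma hoare_while (t : pred S) I U B :
  hoare (fun s => t s /\ I s) U B I U ->
  hoare I U (CWhile t B) (fun s => ~~ t s /\ I s) U.
Proof.
move=> /hoareP valid; apply/hoareP => s tau k Is ex.
(* Naming the loop lets the induction on the derivation remember which command is executed; its
   hypothesis is then used for the remaining iterations. *)
move ew: (CWhile t B) ex => w ex.
elim: ex ew Is => {s tau k w} // [s t' c nts|
  s s1 t' c tau1 tau2 k ts ex1 _ _ IH|
  s t' c tau ts ex1 _] [? ?] Is; subst.
- by exists s; split=> // x; rewrite cats0.
- have [_ [[<-] Is1 U1]] := valid _ _ _ (conj ts Is) ex1.
  have [s2 [-> Qs2 U2]] := IH erefl Is1; exists s2.
  by split=> // x /U1 /U2; rewrite catA.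
- by have [? []] := valid _ _ _ (conj ts Is) ex1.
Qed.

Lemma hoare_frame P Q U V W c :
  (forall s s', P s -> Q s' -> lang (eval W s) = lang (eval W s')) ->
  hoare P U c Q V -> hoare P (SCat W U) c Q (SCat W V).
Proof.
move=> Wconst /hoareP valid; apply/hoareP => s tau k Ps.
move=> /(valid _ _ _ Ps) [s' [-> Qs' UV]]; exists s'; split=> //.
(* The framed prefix [w] is a word of [W] at the initial state and must be one at the final state;
   [Wconst] transports it. *)
move=> _ [w Ww [x /UV Vx <-]]; rewrite -catA; exists w.
  by rewrite -(Wconst s).
by exists (x ++ tau).
Qed.

(* Framing the premise with v* turns it into {t /\ I | v*} B {I | v* v}; as
   v* v is included in v*, the ordinary while rule applies with invariant v*. *)
Lemma hoare_while_star (t : pred S) I (v : regex A) B :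
  hoare (fun s => t s /\ I s) (plain REps) B I (plain v) ->
  hoare I (plain REps) (CWhile t B) (fun s => ~~ t s /\ I s)
    (plain (RStar v)).
Proof.
move=> valid; pose vs : spec A S := plain (RStar v).
have framed : hoare (fun s => t s /\ I s) (SCat vs (plain REps)) B
    I (SCat vs (plain v)).
  (* A plain expression evaluates alike in all states, so the side condition of the frame rule
     holds. *)
  by apply: hoare_frame valid => s s' _ _; rewrite !eval_plain.
have inv : hoare (fun s => t s /\ I s) vs B I vs.
  apply: (hoare_conseq _ framed) => s pre; split=> // x.
    by move=> vx; exists x => //; exists [::]; rewrite ?eval_plain ?cats0.
  rewrite -[eval (SCat _ _) s]/(RCat (eval vs s) (eval (plain v) s)).
  rewrite !eval_plain => -[y vy [z vz <-]].
  exact: lang_star_catr.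
(* The initial history is the empty word, which lies in every star. *)
apply: (hoare_conseq _ (hoare_while inv)) => s // Is; split=> // x.
by rewrite !eval_plain => ->; apply: lang_star_nil.
Qed.

End Rules.

Theorem mainTheorem1 (A : finType) (Var : eqType) (Val : Type) :
  (* Emit *)
  (forall (P : state Var Val -> Prop) (U : spec A (state Var Val)) (a : A),
      hoare P U (emit a) P (SCat U (plain (RSym a)))) /\
  (* Spec *)
  (forall (P G Q : state Var Val -> Prop)
          (R : state Var Val -> state Var Val -> Prop)
          (U V W : spec A (state Var Val)) (xs : seq Var),
      (forall s, P s -> G s) ->
      (forall s s' (vs : seq Val), size vs = size xs -> s' = update s xs vs ->
        P s /\ R s s' ->
        Q s' /\ lang (RCat (eval U s) (eval W s)) `<=` lang (eval V s')) ->
      hoare P U (CSpec xs G R W) Q V) /\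
  (* Conseq *)
  (forall (P1 P2 Q1 Q2 : state Var Val -> Prop)
          (U1 U2 V1 V2 : spec A (state Var Val)) (c : cmd A Var Val),
      (forall s, P1 s -> P2 s /\ lang (eval U1 s) `<=` lang (eval U2 s)) ->
      hoare P2 U2 c Q2 V2 ->
      (forall s, Q2 s -> Q1 s /\ lang (eval V2 s) `<=` lang (eval V1 s)) ->
      hoare P1 U1 c Q1 V1) /\
  (* Seq *)
  (forall (P Q R : state Var Val -> Prop) (U V W : spec A (state Var Val))
          (c1 c2 : cmd A Var Val),
      hoare P U c1 Q V ->
      hoare Q V c2 R W ->
      hoare P U (CSeq c1 c2) R W) /\
  (* While *)
  (forall (t : pred (state Var Val)) (I : state Var Val -> Prop)
          (U : spec A (state Var Val)) (B : cmd A Var Val),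
      hoare (fun s => t s /\ I s) U B I U ->
      hoare I U (CWhile t B) (fun s => ~~ t s /\ I s) U) /\
  (* Frame *)
  (forall (P Q : state Var Val -> Prop) (U V W : spec A (state Var Val))
          (c : cmd A Var Val),
      (forall s s', P s -> Q s' -> lang (eval W s) = lang (eval W s')) ->
      hoare P U c Q V ->
      hoare P (SCat W U) c Q (SCat W V)) /\
  (* While* *)
  (forall (t : pred (state Var Val)) (I : state Var Val -> Prop)
          (v : regex A) (B : cmd A Var Val),
      hoare (fun s => t s /\ I s) (plain REps) B I (plain v) ->
      hoare I (plain REps) (CWhile t B) (fun s => ~~ t s /\ I s)
        (plain (RStar v))).
Proof.
split; first exact: hoare_emit.
split; first exact: hoare_spec.
split; first exact: hoare_conseq.
split; first exact: hoare_seq.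
split; first exact: hoare_while.
split; first exact: hoare_frame.
exact: hoare_while_star.
Qed.
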